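(* The finite projective plane $\Omega$ of order $9$ is not a Poncelet plane.
   Context: Miniquaternion near-field $\mathfrak{S}=\{0,\pm1,\pm i,\pm j,\pm k\}$: as an additive group it is $\{a+bi: a,b\in GF(3)\}$ with $j:=1+i$, $k:=1-i$ (coefficients mod $3$); multiplication on $\mathfrak{S}\setminus\{0\}$ is the quaternion group: $i^2=j^2=k^2=-1$, $ij=k=-ji$, $jk=i=-kj$, $ki=j=-ik$, $-1$ central, $0\cdot x=x\cdot 0=0$; it satisfies $(m+n)l=ml+nl$ but not left distributivity. The plane $\Omega$ has points: the $81$ proper points $(x,y)$, $x,y\in\mathfrak{S}$; the $9$ ideal points $(1,\mu,0)$, $\mu\in\mathfrak{S}$; and the ideal point $(0,1,0)$. Its lines: for $\mu,\nu\in\mathfrak{S}$ the line $y=x\mu+\nu$, consisting of the proper points $(x,y)$ with $y=x\mu+\nu$ together with the ideal point $(1,\mu,0)$; for $\lambda\in\mathfrak{S}$ the line $x=\lambda$, consisting of the points $(\lambda,y)$, $y\in\mathfrak{S}$, and $(0,1,0)$; and the ideal line consisting of all $10$ ideal points. This is a projective plane of order $9$. An oval in a plane of order $n$ is a set of $n+1$ points no three collinear; secants/tangents of an oval are lines meeting it in two/exactly one point. For an ordered pair of ovals $(O_t,O_s)$, an $m$-sided Poncelet polygon ($3\le m\le n+1$) is a cyclically ordered $m$-tuple of distinct points of $O_s$ with every line joining cyclically consecutive vertices a tangent of $O_t$. $(O_t,O_s)$ is a Poncelet $m$-pair if an $m$-sided Poncelet polygon exists but no $m'$-sided one for $m'\neq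 m$, $3\le m'\le n+1$; a Poncelet $0$-pair if no secant of $O_s$ is a tangent of $O_t$; a Poncelet $\infty$-pair if some secant of $O_s$ is tangent to $O_t$ but no Poncelet polygon exists. A Poncelet plane is one in which every pair of ovals is a Poncelet $m$-pair ($3\le m\le n+1$), a Poncelet $0$-pair or a Poncelet $\infty$-pair. *)

(* Defs.v *)
From HB Require Import structures.
From mathcomp Require Import all_boot all_order all_algebra.
Set Implicit Arguments.
Unset Strict Implicit.
Unset Printing Implicit Defensive.
Import GRing.Theory.
Local Open Scope ring_scope.

Record proj_plane (n : nat) := ProjPlane {
  point : finType;
  line : finType;
  inc : point -> line -> bool;
  join_unique : forall P Q : point, P != Q -> exists! l : line, inc P l && inc Q l;
  meet_unique : forall l k : line, l != k -> exists! P : point, inc P l && inc P k;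
  quadrangle : exists A B C D : point,
    uniq [:: A; B; C; D] /\
    forall l : line, (count (fun P => inc P l) [:: A; B; C; D] <= 2)%N;
  line_card : forall l : line, #|[set P | inc P l]| = n.+1
}.

Definition collinear n (Pi : proj_plane n) (P Q R : point Pi) : bool :=
  [exists l : line Pi, [&& inc P l, inc Q l & inc R l]].

Definition oval n (Pi : proj_plane n) (O : {set point Pi}) : Prop :=
  #|O| = n.+1 /\
  forall P Q R : point Pi, P \in O -> Q \in O -> R \in O ->
    uniq [:: P; Q; R] -> ~~ collinear P Q R.

Definition secant n (Pi : proj_plane n) (O : {set point Pi}) (l : line Pi) : bool :=
  #|[set P in O | inc P l]| == 2.

Definition tangent n (Pi : proj_plane n) (O : {set point Pi}) (l : line Pi) : bool :=
  #|[set P in O | inc P l]| == 1.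

Definition tangent_join n (Pi : proj_plane n) (O : {set point Pi})
    (P Q : point Pi) : bool :=
  [exists l : line Pi, [&& inc P l, inc Q l & tangent O l]].

(* [cycle] also relates the last vertex to the first one.  Consecutive         *)
(* vertices are distinct, so the line in [tangent_join] is their unique join.  *)
Definition poncelet_polygon n (Pi : proj_plane n) (Ot Os : {set point Pi})
    (m : nat) (t : m.-tuple (point Pi)) : Prop :=
  [/\ (3 <= m <= n.+1)%N, uniq t, {subset t <= Os} & cycle (tangent_join Ot) t].

Definition has_poncelet_polygon n (Pi : proj_plane n) (Ot Os : {set point Pi})
    (m : nat) : Prop :=
  exists t : m.-tuple (point Pi), poncelet_polygon Ot Os t.

Definition poncelet_pair n (Pi : proj_plane n) (Ot Os : {set point Pi})
    (m : nat) : Prop :=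
  has_poncelet_polygon Ot Os m /\
  forall m' : nat, (3 <= m' <= n.+1)%N -> m' <> m -> ~ has_poncelet_polygon Ot Os m'.

Definition poncelet_zero_pair n (Pi : proj_plane n) (Ot Os : {set point Pi}) : Prop :=
  forall l : line Pi, secant Os l -> ~~ tangent Ot l.

Definition poncelet_infty_pair n (Pi : proj_plane n) (Ot Os : {set point Pi}) : Prop :=
  (exists l : line Pi, secant Os l && tangent Ot l) /\
  forall m : nat, (3 <= m <= n.+1)%N -> ~ has_poncelet_polygon Ot Os m.

Definition poncelet_plane n (Pi : proj_plane n) : Prop :=
  forall Ot Os : {set point Pi}, oval Ot -> oval Os ->
    [\/ exists2 m : nat, (3 <= m <= n.+1)%N & poncelet_pair Ot Os m,
        poncelet_zero_pair Ot Os
      | poncelet_infty_pair Ot Os].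

(* The pair (a, b) stands for a + b i.  Only the additive structure of         *)
(* 'F_3 * 'F_3 is meant: its componentwise ring product is not the product of  *)
(* the near-field, which is [mq_mul] below.                                    *)
Definition mq : Type := ('F_3 * 'F_3)%type.
HB.instance Definition _ := Finite.on mq.
HB.instance Definition _ := GRing.Zmodule.on mq.

Definition mq1 : mq := (1, 0).
Definition mqi : mq := (0, 1).
Definition mqj : mq := mq1 + mqi.
Definition mqk : mq := mq1 - mqi.

Definition mq_units : seq mq := [:: mq1; mqi; mqj; mqk].

Definition mq_table : seq (seq mq) :=
  [:: [:: mq1;   mqi;   mqj;   mqk];
      [:: mqi; - mq1;   mqk; - mqj];
      [:: mqj; - mqk; - mq1;   mqi];
      [:: mqk;   mqj; - mqi; - mq1]].

(* Every nonzero x is either u or - u for exactly one u in [mq_units].         *)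
Definition mq_abs (x : mq) : mq := if x \in mq_units then x else - x.

Definition mq_mul (x y : mq) : mq :=
  if (x == 0) || (y == 0) then 0 else
  let p := nth 0 (nth [::] mq_table (index (mq_abs x) mq_units))
                 (index (mq_abs y) mq_units) in
  if (x \in mq_units) == (y \in mq_units) then p else - p.

Definition mq_elems : seq mq :=
  [:: 0; mq1; - mq1; mqi; - mqi; mqj; - mqj; mqk; - mqk].

Lemma mem_mq_elems (x : mq) : x \in mq_elems.
Proof.
by case: x => [[[|[|[|?]]] //= ?] [[|[|[|?]]] //= ?]]; vm_compute.
Qed.

Lemma mq_all (p : pred mq) : all p mq_elems -> forall x, p x.
Proof. by move=> /allP h x; apply/h/mem_mq_elems. Qed.

Lemma mq_mulDl (x y z : mq) : mq_mul (x + y) z = mq_mul x z + mq_mul y z.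
Proof.
apply/eqP; move: z; apply: mq_all; move: y; apply: mq_all; move: x.
by apply: mq_all; vm_compute.
Qed.

Lemma mq_mul_quaternion :
  [/\ [/\ mq_mul mqi mqi = - mq1, mq_mul mqj mqj = - mq1 & mq_mul mqk mqk = - mq1],
      mq_mul mqi mqj = mqk /\ mq_mul mqj mqi = - mqk,
      mq_mul mqj mqk = mqi /\ mq_mul mqk mqj = - mqi
    & mq_mul mqk mqi = mqj /\ mq_mul mqi mqk = - mqj].
Proof. by do !split; apply/eqP; vm_compute. Qed.

Inductive omega_point :=
| Proper of mq & mq      (* (x, y)      *)
| Ideal of mq            (* (1, mu, 0)  *)
| IdealY.                (* (0, 1, 0)   *)

Inductive omega_line :=
| Slope of mq & mq       (* y = x mu + nu, from mu and nu *)
| Vertical of mq         (* x = lambda *)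
| IdealLine.

Definition omega_point_code (P : omega_point) : (mq * mq) + option mq :=
  match P with
  | Proper x y => inl (x, y) | Ideal mu => inr (Some mu) | IdealY => inr None
  end.

Definition omega_point_decode (c : (mq * mq) + option mq) : omega_point :=
  match c with
  | inl (x, y) => Proper x y | inr (Some mu) => Ideal mu | inr None => IdealY
  end.

Lemma omega_point_codeK : cancel omega_point_code omega_point_decode.
Proof. by case. Qed.

HB.instance Definition _ := Finite.copy omega_point (can_type omega_point_codeK).

Definition omega_line_code (l : omega_line) : (mq * mq) + option mq :=
  match l with
  | Slope mu nu => inl (mu, nu) | Vertical c => inr (Some c) | IdealLine => inr None
  end.

Definition omega_line_decode (c : (mq * mq) + option mq) : omega_line :=
  match c with
  | inl (mu, nu) => Slope mu nu | inr (Some c) => Vertical c | inr None => IdealLine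
  end.

Lemma omega_line_codeK : cancel omega_line_code omega_line_decode.
Proof. by case. Qed.

HB.instance Definition _ := Finite.copy omega_line (can_type omega_line_codeK).

Definition omega_inc (P : omega_point) (l : omega_line) : bool :=
  match P, l with
  | Proper x y, Slope mu nu => y == mq_mul x mu + nu
  | Proper x _, Vertical lambda => x == lambda
  | Proper _ _, IdealLine => false
  | Ideal m, Slope mu _ => m == mu
  | Ideal _, Vertical _ => false
  | Ideal _, IdealLine => true
  | IdealY, Slope _ _ => false
  | IdealY, Vertical _ => true
  | IdealY, IdealLine => true
  end.

Definition omega_points : seq omega_point :=
  [seq Proper x y | x <- mq_elems, y <- mq_elems]
    ++ [seq Ideal mu | mu <- mq_elems] ++ [:: IdealY].

Definition omega_lines : seq omega_line :=
  [seq Slope mu nu | mu <- mq_elems, nu <- mq_elems]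
    ++ [seq Vertical c | c <- mq_elems] ++ [:: IdealLine].

Lemma mem_cat3 (T : eqType) (s1 s2 s3 : seq T) (x : T) :
  (x \in s1 ++ s2 ++ s3) = [|| x \in s1, x \in s2 | x \in s3].
Proof. by rewrite !mem_cat. Qed.

Lemma mem_omega_points (P : omega_point) : P \in omega_points.
Proof.
rewrite mem_cat3; case: P => [x y|mu|]; last by rewrite mem_head !orbT.
  by apply/orP; left; apply: allpairs_f_dep; apply: mem_mq_elems.
by apply/orP; right; apply/orP; left; apply: map_f; apply: mem_mq_elems.
Qed.

Lemma mem_omega_lines (l : omega_line) : l \in omega_lines.
Proof.
rewrite mem_cat3; case: l => [mu nu|c|]; last by rewrite mem_head !orbT.
  by apply/orP; left; apply: allpairs_f_dep; apply: mem_mq_elems.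
by apply/orP; right; apply/orP; left; apply: map_f; apply: mem_mq_elems.
Qed.

Lemma omega_points_uniq : uniq omega_points.
Proof. by vm_compute. Qed.

Lemma omega_lines_uniq : uniq omega_lines.
Proof. by vm_compute. Qed.

Lemma count1_exists_unique (T : eqType) (s : seq T) (p : pred T) :
  (forall x, x \in s) -> count p s = 1%N -> exists! x, p x.
Proof.
move=> s_all; rewrite -size_filter.
case E: (filter p s) => [|x [|? ?]] // _.
have memE y : p y = (y \in [:: x]) by rewrite -E mem_filter s_all andbT.
exists x; split=> [|y]; rewrite memE ?mem_head //.
by rewrite inE => /eqP.
Qed.

Lemma check_exists_unique (T U : eqType) (r : T -> U -> bool) (s : seq T) (u : seq U) :
  (forall x, x \in s) -> (forall y, y \in u) ->
  all (fun x => let v := filter (r x) u in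
       all (fun y => (x == y) || (count (r y) v == 1)%N) s) s ->
  forall x y : T, x != y -> exists! z, r x z && r y z.
Proof.
move=> s_all u_all /allP check x y neqxy; apply: (count1_exists_unique u_all).
have /allP/(_ y (s_all y)) := check x (s_all x).
rewrite (negPf neqxy) => /eqP; rewrite count_filter => <-.
by apply: eq_count => z /=; rewrite andbC.
Qed.

Lemma omega_join_unique (P Q : omega_point) :
  P != Q -> exists! l, omega_inc P l && omega_inc Q l.
Proof.
move: P Q; apply: (check_exists_unique mem_omega_points mem_omega_lines).
by vm_compute.
Qed.

Lemma omega_meet_unique (l k : omega_line) :
  l != k -> exists! P, omega_inc P l && omega_inc P k.
Proof.
move: l k; apply: (@check_exists_unique _ _ (fun l P => omega_inc P l) _ _
                     mem_omega_lines mem_omega_points).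
by vm_compute.
Qed.

Lemma omega_quadrangle : exists A B C D : omega_point,
  uniq [:: A; B; C; D] /\
  forall l, (count (fun P => omega_inc P l) [:: A; B; C; D] <= 2)%N.
Proof.
exists (Proper 0 0), (Proper mq1 mq1), (Ideal 0), IdealY; split; first by vm_compute.
by move=> l; move: l (mem_omega_lines l); apply/allP; vm_compute.
Qed.

Lemma omega_line_card (l : omega_line) : #|[set P | omega_inc P l]| = 10%N.
Proof.
rewrite cardsE cardE -(perm_size (s1 := filter (omega_inc^~ l) omega_points)).
  apply/eqP; move: l (mem_omega_lines l); apply/allP; by vm_compute.
apply: uniq_perm; rewrite ?enum_uniq ?filter_uniq ?omega_points_uniq // => P.
by rewrite mem_filter mem_omega_points andbT mem_enum.
Qed.

Definition Omega : proj_plane 9 :=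
  ProjPlane omega_join_unique omega_meet_unique omega_quadrangle omega_line_card.

(* Main.v *)
Require Import Defs.
From mathcomp Require Import all_boot all_algebra.
Set Implicit Arguments.
Unset Strict Implicit.
Unset Printing Implicit Defensive.
Local Open Scope ring_scope.

(** In a Poncelet plane all Poncelet polygons of an ordered pair of ovals have
    the same number of sides.  A computer search over pairs of random ovals of
    Omega found a pair admitting both a triangle and a quadrangle. *)

Section ExplicitOvals.
Variables (n : nat) (Pi : proj_plane n).
Implicit Types (s t : seq (point Pi)) (l : line Pi).

(** Cardinals of finite sets evaluate badly, whereas [count] on an explicit list is fit for
    [vm_compute]. *)
Lemma card_points_on s l :
  uniq s -> #|[set P in [set Q in s] | inc P l]| = count (fun P => inc P l) s.
Proof.
move=> s_uniq; rewrite -size_filter -(card_uniqP (filter_uniq _ s_uniq)).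
by apply: eq_card => P; rewrite !inE mem_filter andbC.
Qed.

Lemma secant_tangent_seq s s' l :
  uniq s -> uniq s' ->
  count (fun P => inc P l) s' == 2%N -> count (fun P => inc P l) s == 1%N ->
  secant [set P in s'] l && tangent [set P in s] l.
Proof. by move=> *; rewrite /secant /tangent !card_points_on //; apply/andP. Qed.

Lemma oval_seq s :
  uniq s -> size s = n.+1 -> (forall l, (count (fun P => inc P l) s <= 2)%N) ->
  oval [set P in s].
Proof.
move=> s_uniq s_size s_arc; split=> [|P Q R].
  by rewrite cardsE (card_uniqP s_uniq).
rewrite !inE => sP sQ sR PQR_uniq; apply/negP => /existsP[l /and3P[lP lQ lR]].
(* Three distinct points of [s] on [l] would exceed the bound 2 of [s_arc]. *)
have : (size [:: P; Q; R] <= size (filter (fun P => inc P l) s))%N.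
  apply: uniq_leq_size => // T; rewrite !inE mem_filter.
  by case/or3P=> /eqP->; rewrite ?lP ?lQ ?lR.
by rewrite size_filter leqNgt ltnS s_arc.
Qed.

(** A tangent found in the list [ls] witnesses the existential in [tangent_join], so the cycle
    condition can be decided by computation. *)
Lemma poncelet_polygon_seq s s' (ls : seq (line Pi)) m (t : m.-tuple (point Pi)) :
  uniq s -> (3 <= m <= n.+1)%N -> uniq t -> all (mem s') t ->
  cycle (fun P Q =>
    has (fun l => [&& inc P l, inc Q l & count (fun R => inc R l) s == 1%N]) ls)
    t ->
  poncelet_polygon [set P in s] [set P in s'] t.
Proof.
move=> s_uniq m_bounds t_uniq /allP ts' t_cycle.
split=> // [P /ts'|]; first by rewrite !inE.
apply: sub_cycle t_cycle => P Q /hasP[l _ /and3P[lP lQ l_tangent]].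
by apply/existsP; exists l; rewrite lP lQ /tangent card_points_on.
Qed.

(** The tangent secant excludes a 0-pair and the m-gon excludes an infinity-pair; in the remaining
    case both polygons have the [k] sides of the pair. *)
Lemma poncelet_plane_sides (Ot Os : {set point Pi}) m m' :
  poncelet_plane Pi -> oval Ot -> oval Os ->
  (exists l, secant Os l && tangent Ot l) ->
  (3 <= m <= n.+1)%N -> (3 <= m' <= n.+1)%N ->
  has_poncelet_polygon Ot Os m -> has_poncelet_polygon Ot Os m' -> m = m'.
Proof.
move=> Pi_poncelet Ot_oval Os_oval [l /andP[l_secant l_tangent]] m_ok m'_ok pm pm'.
case: (Pi_poncelet _ _ Ot_oval Os_oval) => [[k _ [_ no_other]]|no_secant|[_ none]].
- have eq_k i : (3 <= i <= n.+1)%N -> has_poncelet_polygon Ot Os i -> i = k.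
    by move=> i_ok pi; case: (eqVneq i k) => // /eqP /(no_other _ i_ok).
  by rewrite (eq_k m) // (eq_k m').
- by have := no_secant _ l_secant; rewrite l_tangent.
- by case: (none m).
Qed.

End ExplicitOvals.

Definition tangent_oval : seq (point Omega) :=
  [:: Proper mqi mq1; Proper mqj mq1; Proper (- mq1) 0; Proper (- mq1) (- mq1);
      Proper (- mqk) mqj; Proper (- mqk) mqk; Proper (- mqj) 0;
      Proper (- mqj) (- mq1); Ideal mq1; Ideal (- mq1)].

Definition secant_oval : seq (point Omega) :=
  [:: Proper mqj 0; Proper mqj mqj; Proper mqk 0; Proper mqk (- mqi);
      Proper (- mq1) (- mqi); Proper (- mq1) mq1; Proper (- mqj) mq1;
      Proper (- mqj) mqj; Ideal mqi; Ideal (- mqi)].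

(** The sides are x = j, y = j and y = x - j, touching [tangent_oval] at (j, 1), (-k, j) and the
    ideal point (1, 1, 0). *)
Definition triangle : 3.-tuple (point Omega) :=
  [tuple Proper mqj 0; Proper mqj mqj; Proper (- mqj) mqj].

(** Proper and ideal vertices alternate, so the sides are the lines of slopes i and -i through the
    two proper vertices. *)
Definition quadrilateral : 4.-tuple (point Omega) :=
  [tuple Proper (- mq1) mq1; Ideal mqi; Proper (- mqj) mq1; Ideal (- mqi)].

Lemma tangent_oval_uniq : uniq tangent_oval.
Proof. by vm_compute. Qed.

Lemma secant_oval_uniq : uniq secant_oval.
Proof. by vm_compute. Qed.

Lemma tangent_ovalP : oval [set P in tangent_oval].
Proof.
apply: (oval_seq tangent_oval_uniq) => // l.
(* [omega_lines] contains all 91 lines, so the arc condition is a finite check. *)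
by move: l (mem_omega_lines l); apply/allP; vm_compute.
Qed.

Lemma secant_ovalP : oval [set P in secant_oval].
Proof.
apply: (oval_seq secant_oval_uniq) => // l.
by move: l (mem_omega_lines l); apply/allP; vm_compute.
Qed.

Lemma triangle_poncelet :
  poncelet_polygon [set P in tangent_oval] [set P in secant_oval] triangle.
Proof.
by apply: (@poncelet_polygon_seq _ Omega _ _ omega_lines _ _ tangent_oval_uniq) => //;
  vm_compute.
Qed.

Lemma quadrilateral_poncelet :
  poncelet_polygon [set P in tangent_oval] [set P in secant_oval] quadrilateral.
Proof.
by apply: (@poncelet_polygon_seq _ Omega _ _ omega_lines _ _ tangent_oval_uniq) => //;
  vm_compute.
Qed.

Theorem theorem10 : ~ poncelet_plane Omega.
Proof.
move=> Omega_poncelet.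
suff : 3%N = 4%N by [].
apply: (poncelet_plane_sides Omega_poncelet tangent_ovalP secant_ovalP) => //.
(* This is the side of [triangle] joining (j, 0) and (j, j). *)
- exists (Vertical mqj).
  by apply: (@secant_tangent_seq _ Omega _ _ _ tangent_oval_uniq secant_oval_uniq);
    vm_compute.
- by exists triangle; apply: triangle_poncelet.
- by exists quadrilateral; apply: quadrilateral_poncelet.
Qed.
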